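(* Let $T>0$, $\omega_0=2\pi/T$, and let $\mathcal G$ be the single-input/single-output linear time-periodic system $$\dot{\mathbf x}(t)=\mathbf Q\mathbf x(t)+\mathbf b(t)u(t),\qquad y(t)=\mathbf c^T(t)\mathbf x(t),$$ with constant $\mathbf Q\in\mathbb R^{n\times n}$ and $T$-periodic $\mathbf b(t),\mathbf c(t)\in\mathbb R^n$ having Fourier expansions $$\mathbf b(t)=\sum_{k=-\infty}^\infty\mathbf b_ke^{\mathrm ik\omega_0t},\qquad\mathbf c(t)=\sum_{k=-\infty}^\infty\mathbf c_ke^{\mathrm ik\omega_0t}.$$ For $N\ge0$ let $\mathcal G_{[N]}$ denote the Fourier-truncated time-periodic system obtained from $\mathcal G$ by replacing $\mathbf b(t)$ and $\mathbf c^T(t)$ by $\sum_{k=-N}^N\mathbf b_ke^{\mathrm ik\omega_0t}$ and $\sum_{k=-N}^N\mathbf c_k^Te^{\mathrm ik\omega_0t}$, and let $H_{[N]}$ be the associated linear time-invariant system with state, input and output matrices $\mathbf Q$, $[\mathbf b_{-N},\dots,\mathbf b_N]$, $[\mathbf c_{-N},\dots,\mathbf c_N]^T$. Let $\mathbf V,\mathbf W\in\mathbb R^{n\times r}$ satisfy $\mathbf W^T\mathbf V=\mathbf I$, and define the reduced time-periodic system $\widetilde{\mathcal G}_{[N]}$ by $$\dot{\widetilde{\mathbf x}}=\mathbf W^T\mathbf Q\mathbf V\,\widetilde{\mathbf x}+\Big(\sum_{k=-N}^N\mathbf W^T\mathbf b_ke^{\mathrm ik\omega_0t}\Big)u,\qquad\widetilde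 y=\Big(\sum_{k=-N}^N\mathbf c_k^T\mathbf Ve^{\mathrm ik\omega_0t}\Big)\widetilde{\mathbf x}.$$ Let $\widetilde H_{[N]}$ be the Petrov–Galerkin approximation of $H_{[N]}$, i.e. the linear time-invariant system with state, input and output matrices $\mathbf W^T\mathbf Q\mathbf V$, $\mathbf W^T[\mathbf b_{-N},\dots,\mathbf b_N]$, $[\mathbf c_{-N},\dots,\mathbf c_N]^T\mathbf V$. Then $$\|\mathcal G-\widetilde{\mathcal G}_{[N]}\|_{\mathcal H_2}\le\|\mathcal G-\mathcal G_{[N]}\|_{\mathcal H_2}+\|\mathcal G_{[N]}-\widetilde{\mathcal G}_{[N]}\|_{\mathcal H_2}\le\|\mathcal G-\mathcal G_{[N]}\|_{\mathcal H_2}+\sqrt{2N+1}\,\|H_{[N]}-\widetilde H_{[N]}\|_{\mathcal H_2}.$$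
   Context: The impulse response of a linear time-periodic system $\dot{\mathbf x}=\mathbf Q\mathbf x+\mathbf b(t)u$, $y=\mathbf c^T(t)\mathbf x$ is $g(t,\tau)=\mathbf c^T(t)e^{\mathbf Q(t-\tau)}\mathbf b(\tau)$ for $t\ge\tau$. The difference of two systems is the system whose impulse response is the difference of the impulse responses. For a time-periodic system $\mathcal G$ with impulse response $g$, $$\|\mathcal G\|_{\mathcal H_2}^2=\frac1T\int_0^T\int_0^\infty|g(t,t-r)|^2\,dr\,dt .$$ A linear time-invariant system with state, input and output matrices $\mathbf A,\mathbf B,\mathbf C$ (i.e. $\dot{\mathbf x}=\mathbf A\mathbf x+\mathbf B\mathbf u$, $\mathbf y=\mathbf C\mathbf x$) has impulse response $\boldsymbol g(t)=\mathbf Ce^{\mathbf At}\mathbf B$, $t\ge0$. For a linear time-invariant system $G$ with impulse response $\boldsymbol g$, $$\|G\|_{\mathcal H_2}^2=\int_0^\infty\mathrm{trace}\big(\boldsymbol g^*(t)\boldsymbol g(t)\big)\,dt,$$ which for stable systems equals $\frac1{2\pi}\int_{-\infty}^\infty\|\mathbf G(\mathrm i\omega)\|_F^2\,d\omega$, where $\mathbf G$ is the transfer function. Both norms are defined by the time-domain integrals and take the value $+\infty$ if the integral diverges. The superscript $T$ on matrices is the transpose without conjugation. *)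

(* Defs.v *)
From HB Require Import structures.
From mathcomp Require Import all_boot all_order all_algebra.
From mathcomp Require Import all_classical all_reals all_analysis.
From mathcomp Require Export complex.
Set Implicit Arguments.
Unset Strict Implicit.
Unset Printing Implicit Defensive.
Import Order.TTheory GRing.Theory Num.Theory.
Import numFieldNormedType.Exports.
Local Open Scope classical_set_scope.
Local Open Scope ring_scope.

Section Systems.
Context {R : realType}.
Implicit Types (T t tau : R) (n m p r N : nat) (k : int).

Definition toC m n (A : 'M[R]_(m, n)) : 'M[R[i]]_(m, n) :=
  map_mx (real_complex R) A.

Definition cis (x : R) : R[i] := Complex (cos x) (sin x).

Definition expmx n (A : 'M[R]_n) : 'M[R]_n :=
  limn (series (fun k : nat => (k`!%:R)^-1 *: A ^+ k)).

Definition cintegral (D : set R) (f : R -> R[i]) : R[i] :=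
  Complex (Rintegral lebesgue_measure D (fun t => complex.Re (f t)))
          (Rintegral lebesgue_measure D (fun t => complex.Im (f t))).

Definition omega0 T : R := 2 * pi / T.

Definition fourier_coef T (f : R -> R) k : R[i] :=
  real_complex R T^-1 *
  cintegral `[0, T] (fun t => real_complex R (f t) * cis (- (k%:~R * omega0 T * t))).

(* The j-th of the 2N+1 frequency indices -N, ..., N. *)
Definition freq N (j : 'I_(2 * N).+1) : int := j%:Z - N%:Z.

Definition trig_poly T N m n (a : int -> 'M[R[i]]_(m, n)) t : 'M[R[i]]_(m, n) :=
  \sum_(j < (2 * N).+1) cis ((freq j)%:~R * omega0 T * t) *: a (freq j).

(* f is integrable over a period, the a k are its Fourier coefficients, and
   the symmetric partial sums converge to f almost everywhere.  By Carleson's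
   theorem the last clause is automatic when f is square integrable.
   Convergence is stated through the modulus because R[i] carries no topology. *)
Definition fourier_expansion T n (f : R -> 'cV[R]_n)
    (a : int -> 'cV[R[i]]_n) : Prop :=
  [/\ forall i, lebesgue_measure.-integrable `[0, T] (fun t => (f t i 0)%:E),
      forall k i, a k i 0 = fourier_coef T (fun t => f t i 0) k
    & {ae lebesgue_measure, forall t, forall i,
        (fun N : nat => Normc.normc ((trig_poly T N a t - toC (f t)) i 0))
          @ \oo --> (0 : R)}].

(* Single-input/single-output linear time-periodic systems
      x' = Q x + b(t) u,  y = c^T(t) x.
    The coefficients b and c^T are complex valued so that Fourier truncations
    with arbitrary coefficients are covered; the state matrix is real. *)
Record ltp n := LTP {
  ltp_Q : 'M[R]_n;
  ltp_b : R -> 'cV[R[i]]_n;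
  ltp_cT : R -> 'rV[R[i]]_n
}.

(* Meaningful for tau <= t. *)
Definition ltp_impulse n (G : ltp n) (t tau : R) : R[i] :=
  (ltp_cT G t *m toC (expmx ((t - tau) *: ltp_Q G)) *m ltp_b G tau) 0 0.

Definition ltp_h2norm T (g : R -> R -> R[i]) : \bar R :=
  sqrte ((T^-1)%:E *
    \int[lebesgue_measure]_(t in `[0%R, T])
      \int[lebesgue_measure]_(r in `[0%R, +oo[) ((Normc.normc (g t (t - r)) ^+ 2)%:E))%E.

(* H2 norm of the difference of two systems, i.e. of the system whose impulse
   response is the difference of theirs. *)
Definition ltp_h2dist T n1 n2 (G1 : ltp n1) (G2 : ltp n2) : \bar R :=
  ltp_h2norm T (fun t tau => ltp_impulse G1 t tau - ltp_impulse G2 t tau).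

(* Linear time-invariant systems x' = A x + B u, y = C x. *)
Record lti n m p := LTI {
  lti_A : 'M[R]_n;
  lti_B : 'M[R[i]]_(n, m);
  lti_C : 'M[R[i]]_(p, n)
}.

Definition lti_impulse n m p (H : lti n m p) (t : R) : 'M[R[i]]_(p, m) :=
  lti_C H *m toC (expmx (t *: lti_A H)) *m lti_B H.

Definition adjmx m p (A : 'M[R[i]]_(p, m)) : 'M[R[i]]_(m, p) :=
  (map_mx conjc A)^T.

(* The trace is real, so that taking its real part loses nothing. *)
Definition lti_h2norm m p (g : R -> 'M[R[i]]_(p, m)) : \bar R :=
  sqrte (\int[lebesgue_measure]_(t in `[0%R, +oo[)
    (complex.Re (\tr (adjmx (g t) *m g t)))%:E)%E.

Definition lti_h2dist n1 n2 m p (H1 : lti n1 m p) (H2 : lti n2 m p) : \bar R :=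
  lti_h2norm (fun t => lti_impulse H1 t - lti_impulse H2 t).

Definition petrov_galerkin n r m p (V W : 'M[R]_(n, r)) (H : lti n m p) :
    lti r m p :=
  LTI (W^T *m lti_A H *m V) (toC W^T *m lti_B H) (lti_C H *m toC V).

Definition fourier_ltp T N n (Q : 'M[R]_n) (b_ : int -> 'cV[R[i]]_n)
    (cT_ : int -> 'rV[R[i]]_n) : ltp n :=
  LTP Q (trig_poly T N b_) (trig_poly T N cT_).

Definition fourier_lti N n (Q : 'M[R]_n) (b_ c_ : int -> 'cV[R[i]]_n) :
    lti n (2 * N).+1 (2 * N).+1 :=
  LTI Q (\matrix_(i, j) b_ (freq j) i 0)
        (\matrix_(i, j) c_ (freq j) i 0)^T.

End Systems.

(* Main.v *)
Require Import Defs.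
From HB Require Import structures.
From mathcomp Require Import all_boot all_order all_algebra.
From mathcomp Require Import all_classical all_reals all_analysis.
From mathcomp Require Import measurable_realfun.
From mathcomp Require Import ring lra.
Set Implicit Arguments.
Unset Strict Implicit.
Unset Printing Implicit Defensive.
Import Order.TTheory GRing.Theory Num.Theory.
Import numFieldNormedType.Exports.
Local Open Scope classical_set_scope.
Local Open Scope ring_scope.

(** Both inequalities are about the L2 norm of the impulse response, seen as a
    function of the pair (t, r) with t in [0, T] and r >= 0, where r is the
    delay t - tau.

    The first one is the triangle inequality of this L2 norm.  Pointwise,
    |z + w|^2 <= (1 + s) |z|^2 + (1 + 1/s) |w|^2 for every s > 0
    ([sqr_normcD_le]); integrating and optimising over s gives the triangle
    inequality for the square roots ([sqrte_triangle]).  This route uses only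
    the monotonicity and the linearity of the iterated integral of nonnegative
    functions, and holds also when some of the norms are infinite.

    For the second one, the difference of the impulse responses of two Fourier
    systems with the same frequencies is
      sum_j sum_k e^(i j w t) e^(i k w (t - r)) M_jk(r),
    with w the fundamental frequency and M(r) the difference of the impulse
    responses of the associated time-invariant systems
    ([ltp_impulse_fourierE]). At fixed r, Cauchy-Schwarz over the 2N+1 output
    frequencies j costs the factor 2N+1, and Parseval over the input
    frequencies k then gives exactly T sum_jk |M_jk(r)|^2, that is T times the
    squared Frobenius norm of M(r) ([integral_bitrig_le]). Exchanging the two
    integrals by Tonelli and integrating over r gives the bound by sqrt(2N+1)
    times the distance of the time-invariant systems
    ([fourier_ltp_h2dist_le]). The reduced periodic system is the Fourier
    system of the Petrov-Galerkin reduction ([petrov_galerkin_fourier]), so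
    that the bound applies to it.

    Linearity of the integral and Tonelli require the impulse responses to be
    jointly measurable in (t, r).  This follows from the measurability of the
    matrix exponential ([measurable_expmxZ]) and from that of the periodic
    coefficients, known on one period ([measurable_periodic]). *)

(** * Measurability of the matrix exponential *)

Section MatrixExponential.
Context {R : realType}.

(** Neighbourhoods of a matrix are finite products of neighbourhoods of its
    entries. *)
Lemma cvg_mx_entries m n (F : nat -> 'M[R]_(m, n)) (L : 'M[R]_(m, n)) :
  (forall i j, F k i j @[k --> \oo] --> L i j) -> F @ \oo --> L.
Proof.
move=> FL A [P /= PL PA].
suff : \forall k \near \oo, forall i j, P i j (F k i j).
  by apply: filterS => k Pk; apply: PA.
apply: filter_forall => i; apply: filter_forall => j.
exact: FL (PL i j).
Qed.

(** The sum of the moduli of all entries bounds the absolute row sums, so it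
    gains one factor for each multiplication by A.  The matrix exponential
    series is thus dominated, entry by entry, by a real exponential series. *)
Lemma mx_entry_exp_le n (A : 'M[R]_n) k i j :
  `|(A ^+ k) i j| <= (\sum_i0 \sum_j0 `|A i0 j0|) ^+ k.
Proof.
set M := \sum_i0 _.
have M0 : 0 <= M by apply: sumr_ge0 => ? _; apply: sumr_ge0.
elim: k i j => [|k IH] i j.
  by rewrite !expr0 mxE; case: (i == j); rewrite ?normr1 ?normr0.
rewrite !exprS mxE (le_trans (ler_norm_sum _ _ _))//.
have rowM : \sum_j0 `|A i j0| <= M.
  by rewrite /M [leRHS](bigD1 i)//= lerDl sumr_ge0// => ? _; apply: sumr_ge0.
apply: le_trans (ler_wpM2r (exprn_ge0 k M0) rowM).
by rewrite mulr_suml ler_sum// => l _; rewrite normrM ler_wpM2l.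
Qed.

Let expmx_term n (A : 'M[R]_n) := fun k : nat => (k`!%:R)^-1 *: A ^+ k.

Lemma series_mxE m n (F : nat -> 'M[R]_(m, n)) i j :
  (fun k => series F k i j) = series (fun k => F k i j).
Proof. by apply/funext => k; rewrite !seriesEnat summxE. Qed.

Lemma is_cvg_expmx_entry n (A : 'M[R]_n) i j :
  cvgn (series (fun k => expmx_term A k i j)).
Proof.
apply: normed_cvg.
apply: series_le_cvg (is_cvg_series_exp_coeff (\sum_i0 \sum_j0 `|A i0 j0|)).
- by move=> k /=.
- by move=> k; apply: sequences.exp_coeff_ge0; do 2![apply: sumr_ge0 => ? _].
- move=> k; rewrite /exp_coeff /= mxE normrM ger0_norm ?invr_ge0//= mulrC.
  by rewrite ler_wpM2r ?invr_ge0// mx_entry_exp_le.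
Qed.

(** The limit defining [expmx] is a limit of matrices; its entries are
    identified by first producing the matrix of the entrywise limits. *)
Lemma cvg_expmx_entry n (A : 'M[R]_n) i j :
  series (fun k => expmx_term A k i j) @ \oo --> expmx A i j.
Proof.
pose L := \matrix_(i, j) limn (series (fun k => expmx_term A k i j)).
have cvgL : series (expmx_term A) @ \oo --> L.
  apply: cvg_mx_entries => i0 j0; rewrite series_mxE mxE.
  exact: is_cvg_expmx_entry.
rewrite (_ : expmx A = L); last by apply/cvg_lim => //; exact: norm_hausdorff.
by rewrite mxE; apply: is_cvg_expmx_entry.
Qed.

(** Entrywise, r |-> exp (r Q) is a pointwise limit of polynomials in r. *)
Lemma measurable_expmxZ n (Q : 'M[R]_n) i j :
  measurable_fun [set: R] (fun r => expmx (r *: Q) i j).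
Proof.
pose h (k : nat) (r : R) : R := series (fun k => expmx_term (r *: Q) k i j) k.
apply: (@measurable_fun_cvg _ _ _ setT h); last first.
  by move=> r _; exact: cvg_expmx_entry.
move=> k; rewrite /h /series/=; apply: measurable_sum => l.
rewrite [X in measurable_fun _ X](_ : _ =
    fun r => r ^+ l * ((l`!)%:R^-1 * (Q ^+ l) i j)).
  exact: measurable_funM (exprn_measurable _) _.
apply/funext => r; rewrite /expmx_term mxE.
have -> : (r *: Q) ^+ l = r ^+ l *: Q ^+ l.
  elim: l => [|l IH]; first by rewrite !expr0 scale1r.
  rewrite !exprS IH -[LHS]/(_ *m _) -[Q * _]/(_ *m _).
  by rewrite -scalemxAl -scalemxAr scalerA.
by rewrite mxE mulrCA.
Qed.

End MatrixExponential.

(** * Complex-valued functions *)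

Section ComplexModulus.
Context {R : realType}.
Implicit Types z w : R[i].

Lemma sqr_normcE z :
  Normc.normc z ^+ 2 = complex.Re z ^+ 2 + complex.Im z ^+ 2.
Proof. by case: z => x y /=; rewrite sqr_sqrtr// addr_ge0// sqr_ge0. Qed.

Lemma normc_ge0 z : 0 <= Normc.normc z.
Proof. by case: z => x y; apply: sqrtr_ge0. Qed.

Lemma normc_cis x : Normc.normc (cis x : R[i]) = 1.
Proof. by rewrite /cis /= cos2Dsin2 sqrtr1. Qed.

Lemma cisD x y : cis (x + y) = cis x * cis y :> R[i].
Proof.
rewrite /cis sinD cosD; apply/eqP; rewrite eq_complex /= addrC eqxx /= addrC.
by apply/eqP; ring.
Qed.

Lemma Re_sum (I : Type) (s : seq I) (f : I -> R[i]) :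
  complex.Re (\sum_(i <- s) f i) = \sum_(i <- s) complex.Re (f i).
Proof. by elim/big_rec2 : _ => [//|i x z _ <-]; case: (f i) z => ? ? []. Qed.

Lemma Im_sum (I : Type) (s : seq I) (f : I -> R[i]) :
  complex.Im (\sum_(i <- s) f i) = \sum_(i <- s) complex.Im (f i).
Proof. by elim/big_rec2 : _ => [//|i x z _ <-]; case: (f i) z => ? ? []. Qed.

Lemma ler_normc_sum (I : Type) (s : seq I) (f : I -> R[i]) :
  Normc.normc (\sum_(i <- s) f i) <= \sum_(i <- s) Normc.normc (f i).
Proof.
elim/big_rec2 : _ => [|i x z _ zx]; first by rewrite Normc.normc0.
by rewrite (le_trans (le_normcD _ _))// lerD2l.
Qed.

(** Cauchy-Schwarz against the constant 1: twice the gap is the sum of all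
    squared differences (x i - x j)^2. *)
Lemma sqr_sum_le n (x : 'I_n -> R) :
  (\sum_i x i) ^+ 2 <= n%:R * \sum_i x i ^+ 2.
Proof.
suff : 0 <= \sum_i \sum_j (x i - x j) ^+ 2.
  rewrite (_ : \sum_i _ = 2 * (n%:R * \sum_i x i ^+ 2 - (\sum_i x i) ^+ 2)).
    by rewrite pmulr_rge0// subr_ge0.
  under eq_bigr do under eq_bigr do rewrite sqrrB.
  have -> : \sum_i \sum_j (x i ^+ 2 - x i * x j *+ 2 + x j ^+ 2) =
     \sum_i (n%:R * x i ^+ 2 - 2 * x i * \sum_j x j + \sum_j x j ^+ 2).
    apply: eq_bigr => i _; rewrite !big_split/= sumr_const card_ord mulr_natl.
    by rewrite mulr_sumr -sumrN; congr (_ + _ + _); apply: eq_bigr => j _; ring.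
  rewrite !big_split/= sumr_const card_ord sumrN -mulr_suml -!mulr_sumr.
  by rewrite -mulr_natl; ring.
by apply: sumr_ge0 => i _; apply: sumr_ge0 => j _; apply: sqr_ge0.
Qed.

(** The squared triangle inequality with its cross term 2|z||w| bounded by
    s|z|^2 + s^-1|w|^2; unlike the triangle inequality itself, it can be
    integrated termwise. *)
Lemma sqr_normcD_le z w s : 0 < s ->
  Normc.normc (z + w) ^+ 2 <=
  (1 + s) * Normc.normc z ^+ 2 + (1 + s^-1) * Normc.normc w ^+ 2.
Proof.
move=> s0; set a := Normc.normc z; set b := Normc.normc w.
have ab : Normc.normc (z + w) ^+ 2 <= (a + b) ^+ 2.
  by rewrite ler_sqr ?nnegrE ?normc_ge0 ?addr_ge0 ?normc_ge0 ?le_normcD.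
apply: (le_trans ab); rewrite -subr_ge0.
rewrite (_ : _ - _ = s^-1 * (s * a - b) ^+ 2); last by field; rewrite gt_eqF.
by rewrite mulr_ge0 ?sqr_ge0// invr_ge0 ltW.
Qed.

End ComplexModulus.

Section ComplexMeasurability.
Context {R : realType} d (X : measurableType d).
Implicit Types f g : X -> R[i].

(** Measurability for the Borel structure of the plane, expressed by
    coordinates. *)
Definition cmeasurable f :=
  measurable_fun [set: X] (fun x => complex.Re (f x)) /\
  measurable_fun [set: X] (fun x => complex.Im (f x)).

Lemma cmeasurableD f g : cmeasurable f -> cmeasurable g ->
  cmeasurable (fun x => f x + g x).
Proof.
move=> [fr fi] [gr gi]; split.
  rewrite [X in measurable_fun _ X](_ : _ =
    (fun x => complex.Re (f x)) \+ (fun x => complex.Re (g x))).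
    exact: measurable_funD.
  by apply/funext => x /=; case: (f x) (g x) => ? ? [].
rewrite [X in measurable_fun _ X](_ : _ =
  (fun x => complex.Im (f x)) \+ (fun x => complex.Im (g x))).
  exact: measurable_funD.
by apply/funext => x /=; case: (f x) (g x) => ? ? [].
Qed.

Lemma cmeasurableM f g : cmeasurable f -> cmeasurable g ->
  cmeasurable (fun x => f x * g x).
Proof.
move=> [fr fi] [gr gi]; split.
  rewrite [X in measurable_fun _ X](_ : _ =
    ((fun x => complex.Re (f x)) \* (fun x => complex.Re (g x))) \-
    ((fun x => complex.Im (f x)) \* (fun x => complex.Im (g x)))).
    by apply: measurable_funB; exact: measurable_funM.
  by apply/funext => x /=; case: (f x) (g x) => ? ? [].
rewrite [X in measurable_fun _ X](_ : _ =
  ((fun x => complex.Re (f x)) \* (fun x => complex.Im (g x))) \+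
  ((fun x => complex.Im (f x)) \* (fun x => complex.Re (g x)))).
  by apply: measurable_funD; exact: measurable_funM.
by apply/funext => x /=; case: (f x) (g x) => ? ? [].
Qed.

Lemma cmeasurable_cst (z : R[i]) : cmeasurable (fun=> z).
Proof. by split; exact: measurable_cst. Qed.

Lemma cmeasurableB f g : cmeasurable f -> cmeasurable g ->
  cmeasurable (fun x => f x - g x).
Proof.
move=> mf mg; rewrite [X in cmeasurable X](_ : _ = fun x => f x + (-1) * g x).
  apply: cmeasurableD => //; apply: cmeasurableM => //; exact: cmeasurable_cst.
by apply/funext => x; rewrite mulN1r.
Qed.

Lemma cmeasurable_sum (I : Type) (s : seq I) (f : I -> X -> R[i]) :
  (forall i, cmeasurable (f i)) -> cmeasurable (fun x => \sum_(i <- s) f i x).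
Proof.
move=> mf; elim: s => [|i s IH].
  under eq_fun do rewrite big_nil; exact: cmeasurable_cst.
under eq_fun do rewrite big_cons; exact: cmeasurableD.
Qed.

Lemma cmeasurable_real (f : X -> R) : measurable_fun [set: X] f ->
  cmeasurable (fun x => real_complex R (f x)).
Proof. by move=> mf; split => //=; exact: measurable_cst. Qed.

Lemma measurable_sqr_normc f : cmeasurable f ->
  measurable_fun [set: X] (fun x => Normc.normc (f x) ^+ 2).
Proof.
move=> [fr fi]; under eq_fun do rewrite sqr_normcE.
by apply: measurable_funD; exact: measurable_funX.
Qed.

Lemma emeasurable_sqr_normc f : cmeasurable f ->
  measurable_fun [set: X] (fun x => (Normc.normc (f x) ^+ 2)%:E).
Proof. by move=> mf; apply/measurable_EFinP; exact: measurable_sqr_normc. Qed.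

Lemma cmeasurable_cis (f : X -> R) : measurable_fun [set: X] f ->
  cmeasurable (fun x => cis (f x)).
Proof.
move=> mf; split => /=; apply: (measurableT_comp _ mf).
  by apply: continuous_measurable_fun; exact: continuous_cos.
by apply: continuous_measurable_fun; exact: continuous_sin.
Qed.

End ComplexMeasurability.

Lemma cmeasurable_comp {R : realType} d1 d2 (X : measurableType d1)
    (Y : measurableType d2) (f : Y -> R[i]) (h : X -> Y) :
  cmeasurable f -> measurable_fun [set: X] h -> cmeasurable (f \o h).
Proof.
move=> [fr fi] mh.
by split; [exact: (measurableT_comp fr mh) | exact: (measurableT_comp fi mh)].
Qed.

(** * Periodic functions *)

Section Periodic.
Context {R : realType}.

Lemma periodic_subz (V : Type) (f : R -> V) T : (forall t, f (t + T) = f t) ->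
  forall (k : int) t, f (t - k%:~R * T) = f t.
Proof.
move=> fT.
have fn (n : nat) t : f (t + n%:R * T) = f t.
  elim: n t => [|n IH] t; first by rewrite mul0r addr0.
  by rewrite -(IH t) -[RHS]fT; congr f; rewrite -natr1; ring.
move=> [n|n] t; first by rewrite -[LHS](fn n) pmulrn subrK.
by rewrite NegzE -[RHS](fn n.+1) mulrNz pmulrn mulNr opprK.
Qed.

(** A periodic function is its restriction to one period composed with the
    reduction of t modulo T, which is measurable because the integer part is
    monotone. *)
Lemma measurable_periodic (f : R -> R) T : 0 < T ->
  (forall t, f (t + T) = f t) -> measurable_fun `[0, T] f ->
  measurable_fun [set: R] f.
Proof.
move=> T0 fT mf.
pose h t := t - (Num.floor (t / T))%:~R * T.
have mh : measurable_fun [set: R] h.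
  apply: measurable_funB => //; apply: measurable_funM => //.
  apply: nondecreasing_measurable => // x y xy.
  by rewrite ler_int floor_ge_int (le_trans (floor_le _))// ler_pM2r// invr_gt0.
rewrite (_ : f = (f \_ `[0, T]) \o h).
  by apply: (measurableT_comp _ mh); apply/(measurable_restrictT _ _).1.
apply/funext => t /=; rewrite patchE ifT; first by rewrite periodic_subz.
rewrite inE/= in_itv/=; have /andP[] := floor_itv (t / T).
rewrite /h subr_ge0 lerBlDr ler_pdivlMr// => -> /=.
by rewrite ltr_pdivrMr// intrD mulrDl mul1r addrC => /ltW.
Qed.

End Periodic.

(** * Iterated integrals over rectangles *)

Section Integration.
Context {R : realType}.
Local Notation mu := (@lebesgue_measure R).
Local Open Scope ereal_scope.

Lemma restrict_rectangle (f : R * R -> \bar R) (D : set R) t r :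
  ((fun r => f (t, r)) \_ D) r = (f \_ (setT `*` D)) (t, r).
Proof.
rewrite !patchE; congr (if _ then _ else _).
by apply/idP/idP; rewrite !inE/= => // -[].
Qed.

(** The measurability part of Tonelli's theorem, applied to the extension of f
    by zero outside of the domain of integration. *)
Lemma measurable_sectional_integral (f : R * R -> \bar R) (D : set R) :
  measurable D -> measurable_fun setT f -> (forall x, 0 <= f x) ->
  measurable_fun setT (fun t => \int[mu]_(r in D) f (t, r)).
Proof.
move=> mD mf f0; pose g := f \_ (setT `*` D).
rewrite [X in measurable_fun _ X](_ : _ = fubini_F mu g); last first.
  apply/funext => t; rewrite /fubini_F [LHS]integral_mkcond.
  by apply: eq_integral => r _; exact: restrict_rectangle.
apply: (@measurable_fun_fubini_tonelli_F _ _ _ _ _ mu g).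
  apply/(measurable_restrictT _ _).1 => //; first exact: measurableX.
  exact: measurable_funS mf.
by move=> x; rewrite /g patchE; case: ifP.
Qed.

Lemma measurable_sectional_integral_snd (f : R * R -> \bar R) (D : set R) :
  measurable D -> measurable_fun setT f -> (forall x, 0 <= f x) ->
  measurable_fun setT (fun r => \int[mu]_(t in D) f (t, r)).
Proof.
move=> mD mf f0.
apply: (@measurable_sectional_integral (f \o (fun z => (z.2, z.1))) D) => //;
  last by move=> z; exact: f0.
apply: (@measurableT_comp _ _ _ _ _ _ f _ (fun z : R * R => (z.2, z.1))) => //.
by apply: measurable_fun_pair; [exact: measurable_snd | exact: measurable_fst].
Qed.

Lemma tonelli_rectangle (f : R * R -> \bar R) (D1 D2 : set R) :
  measurable D1 -> measurable D2 ->
  measurable_fun setT f -> (forall x, 0 <= f x) ->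
  \int[mu]_(t in D1) \int[mu]_(r in D2) f (t, r) =
  \int[mu]_(r in D2) \int[mu]_(t in D1) f (t, r).
Proof.
move=> mD1 mD2 mf f0; pose g := f \_ (D1 `*` D2).
have gE t r : g (t, r) = (if (t \in D1) && (r \in D2) then f (t, r) else 0).
  rewrite /g patchE; congr (if _ then _ else _).
  by apply/idP/andP; rewrite !inE.
transitivity (\int[mu]_t \int[mu]_r g (t, r)).
  rewrite integral_mkcond; apply: eq_integral => t _; rewrite patchE.
  case: ifPn => tD; last first.
    by rewrite integral0_eq// => r _; rewrite gE (negbTE tD).
  rewrite integral_mkcond; apply: eq_integral => r _.
  by rewrite gE tD patchE.
transitivity (\int[mu]_r \int[mu]_t g (t, r)); last first.
  rewrite [RHS]integral_mkcond; apply: eq_integral => r _; rewrite patchE.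
  case: ifPn => rD; last first.
    by rewrite integral0_eq// => t _; rewrite gE (negbTE rD) andbF.
  rewrite [RHS]integral_mkcond; apply: eq_integral => t _.
  by rewrite gE rD andbT patchE.
apply: fubini_tonelli.
  apply/(measurable_restrictT _ _).1 => //; first exact: measurableX.
  exact: measurable_funS mf.
by move=> x; rewrite /g patchE; case: ifP.
Qed.

(** For finite positive A and B the right-hand side is minimal at
    s = sqrt (B / A), with value (sqrt A + sqrt B)^2.  As A or B may vanish,
    both square roots are shifted by a small d > 0 in the choice of s. *)
Lemma sqrte_triangle (A B C : \bar R) : 0 <= A -> 0 <= B ->
  (forall s : R, (0 < s)%R -> C <= (1 + s)%:E * A + (1 + s^-1)%:E * B) ->
  sqrte C <= sqrte A + sqrte B.
Proof.
move: A B C => [a| |] [b| |] C //=; rewrite ?leey// !lee_fin => a0 b0 CAB.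
set p := Num.sqrt a; set q := Num.sqrt b.
have p0 : (0 <= p)%R by exact: sqrtr_ge0.
have q0 : (0 <= q)%R by exact: sqrtr_ge0.
have aE : a = (p ^+ 2)%R by rewrite sqr_sqrtr.
have bE : b = (q ^+ 2)%R by rewrite sqr_sqrtr.
have : C <= ((p + q) ^+ 2)%:E.
  apply/lee_addgt0Pr => e e0.
  have pq1 : (0 < p + q + 1)%R by rewrite ltr_wpDl// addr_ge0.
  (* d (sqrt a + sqrt b) bounds the loss caused by the shift *)
  pose d := (e / (p + q + 1))%R.
  have d0 : (0 < d)%R by rewrite divr_gt0.
  have pd0 : (0 < p + d)%R by rewrite ltr_wpDl.
  have qd0 : (0 < q + d)%R by rewrite ltr_wpDl.
  apply: (le_trans (CAB ((q + d) / (p + d))%R _)); first by rewrite divr_gt0.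
  rewrite -!EFinM -!EFinD lee_fin invf_div aE bE.
  have pE : (p ^+ 2 / (p + d) <= p)%R.
    by rewrite ler_pdivrMr// expr2 ler_wpM2l// lerDl ltW.
  have qE : (q ^+ 2 / (q + d) <= q)%R.
    by rewrite ler_pdivrMr// expr2 ler_wpM2l// lerDl ltW.
  have dE : (d * (p + q) <= e)%R.
    by rewrite -[leRHS](divfK (lt0r_neq0 pq1)) -/d ler_wpM2l ?ltW// ltrDl.
  have := ler_wpM2r (ltW qd0) pE; have := ler_wpM2r (ltW pd0) qE.
  rewrite (_ : (1 + _) * _ = p ^+ 2 + p ^+ 2 / (p + d) * (q + d))%R;
    last by ring.
  rewrite (_ : (1 + _) * _ = q ^+ 2 + q ^+ 2 / (q + d) * (p + d))%R;
    last by ring.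
  by nra.
move=> /(le_trans _) le_C; rewrite -[leRHS]/(p + q)%:E.
rewrite -[(p + q)%R]ger0_norm ?addr_ge0// -sqrtr_sqr.
rewrite -[leRHS]/(sqrte ((p + q) ^+ 2)%:E) lee_sqrt ?lee_fin ?sqr_ge0//.
exact: le_C.
Qed.

End Integration.

(** * Parseval's identity for trigonometric polynomials *)

Section Parseval.
Context {R : realType}.
Local Notation mu := (@lebesgue_measure R).

(** The fundamental theorem of calculus asks for a continuous integrand; for
    trigonometric sums continuity comes from the derivative f'. *)
Lemma integral_derivative (F f f' : R -> R) (a b : R) : a < b ->
  (forall x : R, is_derive x 1 F (f x)) ->
  (forall x : R, is_derive x 1 f (f' x)) ->
  (\int[mu]_(x in `[a, b]) (f x)%:E)%E = (F b - F a)%:E.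
Proof.
move=> ab dF df.
have cF x : {for x, continuous F}.
  by apply/differentiable_continuous/derivable1_diffP; case: (dF x).
rewrite (@continuous_FTC2 _ f F a b)//.
- by apply: derivable_within_continuous => x _; case: (df x).
- split; first by move=> x _; case: (dF x).
    exact/cvg_at_right_filter/cF.
  exact/cvg_at_left_filter/cF.
- by move=> x _; rewrite derive1E; apply: derive_val.
Qed.

Lemma is_derive_harmonic (x y v t : R) :
  is_derive t 1 (fun t => x * cos (v * t) - y * sin (v * t))
    (- v * (x * sin (v * t) + y * cos (v * t))).
Proof.
have dv : is_derive t 1 ( *%R v) v.
  by apply: is_derive_eq; rewrite /= [LHS]mulr1.
have dc := is_derive1_comp (is_derive_cos (v * t)) dv.
have ds := is_derive1_comp (is_derive_sin (v * t)) dv.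
have -> : (fun t => x * cos (v * t) - y * sin (v * t)) =
  x *: (cos \o ( *%R v)) - y *: (sin \o ( *%R v)) by [].
apply: is_derive_eq; rewrite /GRing.scale/=; ring.
Qed.

Definition harmonic_primitive (x y v t : R) :=
  if v == 0 then x * t else (x * sin (v * t) + y * cos (v * t)) / v.

Lemma is_derive_harmonic_primitive (x y v t : R) :
  is_derive t 1 (harmonic_primitive x y v) (x * cos (v * t) - y * sin (v * t)).
Proof.
rewrite /harmonic_primitive; case: eqP => [->|/eqP v0].
  have -> : (fun t => x * t) = x *: (@id R) by [].
  by apply: is_derive_eq; rewrite /GRing.scale/= mul0r cos0 sin0; ring.
have -> : (fun t => (x * sin (v * t) + y * cos (v * t)) / v) =
    (v^-1) *: (fun t => y * cos (v * t) - (- x) * sin (v * t)).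
  by apply/funext => s;
  rewrite -[RHS]/(v^-1 * (y * cos (v * s) - - x * sin (v * s))); field.
have dh := is_derive_harmonic y (- x) v t.
apply: is_derive_eq.
by rewrite /GRing.scale/=; field.
Qed.

(** The (j, k) term is the real part of a_j conj(a_k) e^(i (v_j - v_k) t). *)
Lemma sqr_normc_trigE m (v : 'I_m -> R) (a : 'I_m -> R[i]) t :
  Normc.normc (\sum_j cis (v j * t) * a j) ^+ 2 =
  \sum_j \sum_k
   ((complex.Re (a j) * complex.Re (a k) + complex.Im (a j) * complex.Im (a k))
      * cos ((v j - v k) * t)
    - (complex.Im (a j) * complex.Re (a k)
       - complex.Re (a j) * complex.Im (a k))
      * sin ((v j - v k) * t)).
Proof.
rewrite sqr_normcE Re_sum Im_sum !expr2 !big_distrl/= -big_split/=.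
apply: eq_bigr => j _; rewrite !big_distrr/= -big_split/=.
apply: eq_bigr => k _; rewrite mulrBl cosB sinB.
case: (a j) (a k) => p q [p' q'] /=.
move: (cos _) (sin _) (cos _) (sin _) => c s c' s'; ring.
Qed.

Lemma cos_2piz (k : int) : cos (k%:~R * (2 * pi)) = 1 :> R.
Proof.
have cosT t : cos (t + 2 * pi) = cos t :> R by rewrite mulr_natl cosD2pi.
have := periodic_subz cosT (- k) 0.
by rewrite sub0r mulrNz mulNr opprK cos0.
Qed.

Lemma sin_2piz (k : int) : sin (k%:~R * (2 * pi)) = 0 :> R.
Proof.
have sinT t : sin (t + 2 * pi) = sin t :> R by rewrite mulr_natl sinD2pi.
have := periodic_subz sinT (- k) 0.
by rewrite sub0r mulrNz mulNr opprK sin0.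
Qed.

(** Off the diagonal v_j - v_k is a nonzero integer multiple of 2 pi / T, so
    that the primitive of the (j, k) term takes the same value at 0 and T; on
    the diagonal that term is the constant |a_j|^2. *)
Lemma parseval_trig m (w : 'I_m -> int) (a : 'I_m -> R[i]) T : 0 < T ->
  injective w ->
  (\int[mu]_(t in `[0%R, T])
    (Normc.normc (\sum_j cis ((w j)%:~R * omega0 T * t) * a j) ^+ 2)%:E)%E =
  (T * \sum_j Normc.normc (a j) ^+ 2)%:E.
Proof.
move=> T0 w_inj; set om := omega0 T.
have om0 : om != 0 by rewrite mulf_neq0 ?invr_eq0 ?gt_eqF// mulr_gt0 ?pi_gt0.
pose v j := (w j)%:~R * om.
pose x j k :=
  complex.Re (a j) * complex.Re (a k) + complex.Im (a j) * complex.Im (a k).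
pose y j k :=
  complex.Im (a j) * complex.Re (a k) - complex.Re (a j) * complex.Im (a k).
pose f : R -> R := \sum_j \sum_k
  (fun t => x j k * cos ((v j - v k) * t) - y j k * sin ((v j - v k) * t)).
pose F : R -> R := \sum_j \sum_k harmonic_primitive (x j k) (y j k) (v j - v k).
have fE t : f t = \sum_j \sum_k
    (x j k * cos ((v j - v k) * t) - y j k * sin ((v j - v k) * t)).
  by rewrite /f fct_sumE; apply: eq_bigr => j _; rewrite fct_sumE.
under eq_integral do rewrite sqr_normc_trigE -fE.
have dF (t : R) : is_derive t 1 F (f t).
  rewrite fE; apply: is_derive_sum => j; apply: is_derive_sum => k.
  exact: is_derive_harmonic_primitive.
have df (t : R) : is_derive t 1 f (\sum_j \sum_k - (v j - v k) *
    (x j k * sin ((v j - v k) * t) + y j k * cos ((v j - v k) * t))).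
  apply: is_derive_sum => j; apply: is_derive_sum => k.
  exact: is_derive_harmonic.
rewrite (integral_derivative T0 dF df).
congr (_%:E); rewrite /F fct_sumE/= -sumrB mulr_sumr.
apply: eq_bigr => j _; rewrite !fct_sumE/= -sumrB.
rewrite (bigD1 j)//= big1 => [|k kj].
  by rewrite /harmonic_primitive subrr eqxx /x sqr_normcE; ring.
have vE : v j - v k = (w j - w k)%:~R * om by rewrite rmorphB/= mulrBl.
have vT : (v j - v k) * T = (w j - w k)%:~R * (2 * pi).
  by rewrite vE /om /omega0; field; rewrite gt_eqF.
have v0 : (v j - v k == 0) = false.
  rewrite vE mulf_eq0 (negbTE om0) orbF intr_eq0 subr_eq0.
  by apply/eqP => /w_inj jk; rewrite jk eqxx in kj.
by rewrite /harmonic_primitive v0 vT !mulr0 cos_2piz sin_2piz cos0 sin0 subrr.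
Qed.
End Parseval.

(** * Impulse responses of linear systems *)

Section Systems.
Context {R : realType}.
Local Notation mu := (@lebesgue_measure R).
Local Notation toC := (@toC R).

Lemma Re_trace_adjmx m p (A : 'M[R[i]]_(p, m)) :
  complex.Re (\tr (adjmx A *m A)) = \sum_i \sum_j Normc.normc (A i j) ^+ 2.
Proof.
rewrite /mxtrace Re_sum exchange_big; apply: eq_bigr => k _; rewrite mxE Re_sum.
apply: eq_bigr => j _; rewrite !mxE sqr_normcE; case: (A j k) => x y /=; ring.
Qed.

Lemma cmeasurable_expmx n (Q : 'M[R]_n) i j :
  cmeasurable (fun r : R => toC (expmx (r *: Q)) i j).
Proof.
under eq_fun do rewrite mxE.
by apply: cmeasurable_real; exact: measurable_expmxZ.
Qed.

Lemma cmeasurable_lti_impulse n m p (H : lti n m p) i j :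
  cmeasurable (fun r : R => lti_impulse H r i j).
Proof.
under eq_fun do rewrite mxE.
apply: cmeasurable_sum => k.
apply: cmeasurableM; last exact: cmeasurable_cst.
under eq_fun do rewrite mxE.
apply: cmeasurable_sum => l.
by apply: cmeasurableM; [exact: cmeasurable_cst | exact: cmeasurable_expmx].
Qed.

(** The state matrix being constant, only the input and output coefficients
    can fail to be measurable. *)
Definition measurable_ltp n (G : @ltp R n) :=
  (forall i, cmeasurable (fun t : R => ltp_b G t i 0)) /\
  (forall i, cmeasurable (fun t : R => ltp_cT G t 0 i)).

(** The variables are the time and the delay, in which the H2 norm is written;
    the delay t - (t - r) = r is then the only argument of the exponential. *)
Lemma cmeasurable_ltp_impulse n (G : ltp n) : measurable_ltp G ->
  cmeasurable (fun z : R * R => ltp_impulse G z.1 (z.1 - z.2)).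
Proof.
move=> [mb mc]; rewrite /ltp_impulse.
under eq_fun do rewrite mxE.
apply: cmeasurable_sum => k; apply: cmeasurableM; last first.
  apply: (cmeasurable_comp (mb k)).
  by apply: measurable_funB; [exact: measurable_fst | exact: measurable_snd].
under eq_fun do rewrite mxE.
apply: cmeasurable_sum => l; apply: cmeasurableM.
  by apply: (cmeasurable_comp (mc l)); exact: measurable_fst.
under eq_fun do rewrite subKr.
by apply: (cmeasurable_comp (cmeasurable_expmx _ _ _)); exact: measurable_snd.
Qed.

(** * The triangle inequality *)

Definition ltp_energy T (g : R -> R -> R[i]) : \bar R :=
  (\int[mu]_(t in `[0%R, T]) \int[mu]_(r in `[0%R, +oo[)
     (Normc.normc (g t (t - r)) ^+ 2)%:E)%E.

Lemma ltp_energy_ge0 T g : (0 <= ltp_energy T g)%E.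
Proof.
by do 2![apply: integral_ge0 => ? _]; rewrite lee_fin sqr_ge0.
Qed.

(** Young's inequality is integrated in r, then in t. *)
Lemma ltp_h2norm_triangle T (g h : R -> R -> R[i]) : 0 < T ->
  cmeasurable (fun z : R * R => g z.1 (z.1 - z.2)) ->
  cmeasurable (fun z : R * R => h z.1 (z.1 - z.2)) ->
  (ltp_h2norm T (fun t tau => (g t tau + h t tau)%R)
    <= ltp_h2norm T g + ltp_h2norm T h)%E.
Proof.
move=> T0 mg mh.
have Tinv0 : (0%:E <= (T^-1)%:E :> \bar R)%E by rewrite lee_fin invr_ge0 ltW.
apply: sqrte_triangle; [exact: mule_ge0 Tinv0 (ltp_energy_ge0 _ _)..|].
move=> s s0.
rewrite muleCA [((1 + s^-1)%:E * _)%E]muleCA -ge0_muleDr; last 2 first.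
- by rewrite mule_ge0 ?ltp_energy_ge0// lee_fin addr_ge0// ltW.
- by rewrite mule_ge0 ?ltp_energy_ge0// lee_fin addr_ge0// ltW// invr_gt0.
apply: lee_wpmul2l => //.
have s1 : 0 <= 1 + s by rewrite addr_ge0// ltW.
have s2 : 0 <= 1 + s^-1 by rewrite addr_ge0// ltW// invr_gt0.
have msq (f : R -> R -> R[i]) :
    cmeasurable (fun z : R * R => f z.1 (z.1 - z.2)) ->
    measurable_fun setT (fun z : R * R =>
      (Normc.normc (f z.1 (z.1 - z.2)) ^+ 2)%:E).
  exact: emeasurable_sqr_normc.
have mr (f : R -> R -> R[i]) t :
    cmeasurable (fun z : R * R => f z.1 (z.1 - z.2)) ->
    measurable_fun setT (fun r : R => (Normc.normc (f t (t - r)) ^+ 2)%:E).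
  by move=> /msq mf; apply: measurableT_comp mf (pair1_measurable t).
have mt (f : R -> R -> R[i]) :
    cmeasurable (fun z : R * R => f z.1 (z.1 - z.2)) ->
    measurable_fun setT (fun t : R =>
    \int[mu]_(r in `[0%R, +oo[) (Normc.normc (f t (t - r)) ^+ 2)%:E)%E.
  move=> /msq mf; apply: (measurable_sectional_integral _ mf) => // z.
  by rewrite lee_fin sqr_ge0.
have mgh := cmeasurableD mg mh.
have sq0 (z : R[i]) : (0 <= (Normc.normc z ^+ 2)%:E)%E.
  by rewrite lee_fin sqr_ge0.
rewrite -ge0_integralZl_EFin//; first last.
- by apply: measurable_funS (mt _ mg).
- by move=> t _; apply: integral_ge0.
rewrite -ge0_integralZl_EFin//; first last.
- by apply: measurable_funS (mt _ mh).
- by move=> t _; apply: integral_ge0.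
rewrite -ge0_integralD//; first last.
- by apply: measurable_funS (measurable_funeM _ (mt _ mh)).
- by move=> t _; rewrite mule_ge0//; apply: integral_ge0.
- by apply: measurable_funS (measurable_funeM _ (mt _ mg)).
- by move=> t _; rewrite mule_ge0//; apply: integral_ge0.
apply: ge0_le_integral => //.
- by move=> t _; apply: integral_ge0.
- exact: measurable_funS (mt (fun t tau => g t tau + h t tau)%R mgh).
- apply: (@measurable_funS _ _ _ _ setT) => //; apply: emeasurable_funD.
    exact: measurable_funeM (mt _ mg).
  exact: measurable_funeM (mt _ mh).
move=> t _.
rewrite -ge0_integralZl_EFin//; last exact: measurable_funS (mr _ t mg).
rewrite -ge0_integralZl_EFin//; last exact: measurable_funS (mr _ t mh).
rewrite -ge0_integralD//; first last.
- by apply: measurable_funS (measurable_funeM _ (mr _ t mh)).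
- by move=> r _; rewrite mule_ge0.
- by apply: measurable_funS (measurable_funeM _ (mr _ t mg)).
- by move=> r _; rewrite mule_ge0.
apply: ge0_le_integral => //.
- exact: measurable_funS (mr (fun t tau => g t tau + h t tau)%R t mgh).
- apply: (@measurable_funS _ _ _ _ setT) => //; apply: emeasurable_funD.
    exact: measurable_funeM (mr _ t mg).
  exact: measurable_funeM (mr _ t mh).
by move=> r _; rewrite -!EFinM -EFinD lee_fin sqr_normcD_le.
Qed.

Lemma ltp_h2dist_triangle T n1 n2 n3 (G1 : ltp n1) (G2 : ltp n2) (G3 : ltp n3) :
  0 < T -> measurable_ltp G1 -> measurable_ltp G2 -> measurable_ltp G3 ->
  (ltp_h2dist T G1 G3 <= ltp_h2dist T G1 G2 + ltp_h2dist T G2 G3)%E.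
Proof.
move=> T0 /cmeasurable_ltp_impulse m1 /cmeasurable_ltp_impulse m2.
move=> /cmeasurable_ltp_impulse m3; rewrite /ltp_h2dist.
rewrite [X in ltp_h2norm T X](_ : _ = fun t tau =>
  (ltp_impulse G1 t tau - ltp_impulse G2 t tau) +
  (ltp_impulse G2 t tau - ltp_impulse G3 t tau)); last first.
  by apply/funext => t; apply/funext => tau; rewrite addrA subrK.
by apply: ltp_h2norm_triangle => //; exact: cmeasurableB.
Qed.

(** * Fourier systems *)

Lemma measurable_fourier_ltp T N n (Q : 'M[R]_n) b_ cT_ :
  measurable_ltp (fourier_ltp T N Q b_ cT_).
Proof.
split=> i /=; rewrite /trig_poly; under eq_fun do rewrite summxE;
  apply: cmeasurable_sum => j; under eq_fun do rewrite mxE;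
  by apply: cmeasurableM; [apply: cmeasurable_cis; exact: measurable_funM
                          | exact: cmeasurable_cst].
Qed.

Lemma measurable_periodic_ltp T n (Q : 'M[R]_n) (b c : R -> 'cV[R]_n) : 0 < T ->
  (forall t, b (t + T) = b t) -> (forall t, c (t + T) = c t) ->
  (forall i, measurable_fun `[0, T] (fun t => b t i 0)) ->
  (forall i, measurable_fun `[0, T] (fun t => c t i 0)) ->
  measurable_ltp (LTP Q (fun t => toC (b t)) (fun t => toC (c t)^T)).
Proof.
move=> T0 bT cT mb mc; split=> i /=.
  under eq_fun do rewrite mxE; apply: cmeasurable_real.
  by apply: (measurable_periodic T0) => // t; rewrite bT.
under eq_fun do rewrite !mxE; apply: cmeasurable_real.
by apply: (measurable_periodic T0) => // t; rewrite cT.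
Qed.

(** The entry (j, k) of the time-invariant impulse response is the coefficient
    of the output frequency j and the input frequency k. *)
Lemma ltp_impulse_fourierE T N n (Q : 'M[R]_n)
    (b_ c_ : int -> 'cV[R[i]]_n) t tau :
  ltp_impulse (fourier_ltp T N Q b_ (fun k => (c_ k)^T)) t tau =
  \sum_j \sum_k cis ((freq j)%:~R * omega0 T * t) *
    (cis ((freq k)%:~R * omega0 T * tau) *
     lti_impulse (fourier_lti N Q b_ c_) (t - tau) j k).
Proof.
rewrite /ltp_impulse /= /trig_poly !mulmx_suml summxE.
apply: eq_bigr => j _; rewrite mulmx_sumr summxE; apply: eq_bigr => k _.
rewrite -!scalemxAl -scalemxAr mxE; congr (_ * _); rewrite mxE; congr (_ * _).
rewrite /lti_impulse /= !mxE; apply: eq_bigr => l _; rewrite !mxE.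
by congr (_ * _); apply: eq_bigr => l' _; rewrite !mxE.
Qed.

Lemma freq_inj N : injective (@freq N).
Proof. by move=> i j /(addIr _) [] /val_inj. Qed.

(** Projection acts on the Fourier coefficients one by one, hence commutes
    with the passage from a Fourier system to its time-invariant system. *)
Lemma petrov_galerkin_fourier n r N (Q : 'M[R]_n) (V W : 'M[R]_(n, r)) b_ c_ :
  petrov_galerkin V W (fourier_lti N Q b_ c_) =
  fourier_lti N (W^T *m Q *m V) (fun k => toC W^T *m b_ k)
    (fun k => (toC V)^T *m c_ k).
Proof.
rewrite /petrov_galerkin /fourier_lti /=; congr LTI.
  by apply/matrixP => i j; rewrite !mxE; apply: eq_bigr => k _; rewrite !mxE.
apply/matrixP => i j; rewrite !mxE; apply: eq_bigr => k _; rewrite !mxE.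
by rewrite mulrC.
Qed.

(** Cauchy-Schwarz over the output frequencies j gives the factor 2N+1 and
    leaves one trigonometric polynomial [p j] for each j, to which Parseval
    applies. *)
Lemma integral_bitrig_le T N (M : 'M[R[i]]_((2 * N).+1)) (r : R) : 0 < T ->
  (\int[mu]_(t in `[0%R, T]) (Normc.normc (\sum_j \sum_k
      cis ((freq j)%:~R * omega0 T * t) *
      (cis ((freq k)%:~R * omega0 T * (t - r)) * M j k)) ^+ 2)%:E
   <= ((2 * N).+1%:R * T * \sum_j \sum_k Normc.normc (M j k) ^+ 2)%:E)%E.
Proof.
move=> T0.
(* the phase of the shift t - r has modulus one and goes to the coefficients *)
pose a j k := cis (- ((freq k)%:~R * omega0 T * r)) * M j k.
pose p j t := \sum_k cis ((freq k)%:~R * omega0 T * t) * a j k.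
have mcis (w : R) : cmeasurable (fun t : R => cis (w * t)).
  by apply: cmeasurable_cis; exact: measurable_funM.
have mp j : cmeasurable (p j).
  apply: cmeasurable_sum => k; apply: cmeasurableM; first exact: mcis.
  exact: cmeasurable_cst.
have gE t : \sum_j \sum_k cis ((freq j)%:~R * omega0 T * t) *
      (cis ((freq k)%:~R * omega0 T * (t - r)) * M j k) =
    \sum_j cis ((freq j)%:~R * omega0 T * t) * p j t.
  apply: eq_bigr => j _; rewrite -mulr_sumr; congr (_ * _).
  by apply: eq_bigr => k _; rewrite mulrBr cisD -mulrA.
under eq_integral do rewrite gE.
have cs t : Normc.normc (\sum_j cis ((freq j)%:~R * omega0 T * t) * p j t) ^+ 2
    <= (2 * N).+1%:R * \sum_j Normc.normc (p j t) ^+ 2.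
  apply: le_trans (sqr_sum_le _).
  rewrite ler_sqr ?nnegrE ?normc_ge0 ?sumr_ge0//; last first.
    by move=> *; exact: normc_ge0.
  apply: le_trans (ler_normc_sum _ _) _; apply: ler_sum => j _.
  by rewrite Normc.normcM normc_cis mul1r.
have msum : measurable_fun setT (fun t : R =>
    (\sum_j (Normc.normc (p j t) ^+ 2)%:E)%E).
  by apply: emeasurable_sum => j; apply: emeasurable_sqr_normc.
apply: (@le_trans _ _ (\int[mu]_(t in `[0%R, T]) ((2 * N).+1%:R%:E *
    \sum_j (Normc.normc (p j t) ^+ 2)%:E))%E).
  apply: ge0_le_integral => //.
  - by move=> t _; rewrite lee_fin sqr_ge0.
  - apply: (@measurable_funS _ _ _ _ setT) => //; apply: emeasurable_sqr_normc.
    apply: cmeasurable_sum => j.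
    by apply: cmeasurableM; [exact: mcis | exact: mp].
  - by apply: measurable_funS (measurable_funeM _ msum).
  - by move=> t _; rewrite sumEFin -EFinM lee_fin.
rewrite ge0_integralZl_EFin//; last 2 first.
- by move=> t _; apply: sume_ge0 => j _; rewrite lee_fin sqr_ge0.
- exact: measurable_funS msum.
rewrite ge0_integral_sum//; last 2 first.
- by move=> j; apply: measurable_funS (emeasurable_sqr_normc (mp j)).
- by move=> j t _; rewrite lee_fin sqr_ge0.
under eq_bigr do rewrite (parseval_trig _ T0 (@freq_inj N)).
rewrite sumEFin -EFinM -mulr_sumr mulrA lee_fin.
rewrite le_eqVlt; apply/orP; left; apply/eqP; congr (_ * _).
apply: eq_bigr => j _; apply: eq_bigr => k _.
by rewrite /a Normc.normcM normc_cis mul1r.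
Qed.

(** Tonelli puts the average over t inside, where [integral_bitrig_le] bounds
    it at each delay r by 2N+1 times the squared Frobenius norm of the
    time-invariant impulse response. *)
Lemma fourier_ltp_h2dist_le T N n1 n2 (Q1 : 'M[R]_n1) (Q2 : 'M[R]_n2)
    (b1 c1 : int -> 'cV[R[i]]_n1) (b2 c2 : int -> 'cV[R[i]]_n2) : 0 < T ->
  (ltp_h2dist T (fourier_ltp T N Q1 b1 (fun k => (c1 k)^T))
      (fourier_ltp T N Q2 b2 (fun k => (c2 k)^T)) <=
   (Num.sqrt (2 * N).+1%:R)%:E *
     lti_h2dist (fourier_lti N Q1 b1 c1) (fourier_lti N Q2 b2 c2))%E.
Proof.
move=> T0.
set G1 := fourier_ltp _ _ Q1 _ _; set G2 := fourier_ltp _ _ Q2 _ _.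
set H1 := fourier_lti N Q1 b1 c1; set H2 := fourier_lti N Q2 b2 c2.
pose M r := lti_impulse H1 r - lti_impulse H2 r.
pose S r := \sum_j \sum_k Normc.normc (M r j k) ^+ 2.
have mM j k : cmeasurable (fun r => M r j k).
  rewrite /M; under eq_fun do rewrite mxE [X in _ + X]mxE.
  by apply: cmeasurableB; exact: cmeasurable_lti_impulse.
have mS : measurable_fun setT (fun r : R => (S r)%:E).
  apply/measurable_EFinP.
  apply: measurable_sum => j; apply: measurable_sum => k.
  exact: measurable_sqr_normc.
have S0 r : (0 <= (S r)%:E)%E.
  by rewrite lee_fin; do 2![apply: sumr_ge0 => ? _]; exact: sqr_ge0.
have mg : measurable_fun setT (fun z : R * R => (Normc.normc
    (ltp_impulse G1 z.1 (z.1 - z.2) - ltp_impulse G2 z.1 (z.1 - z.2)) ^+ 2)%:E).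
  apply: emeasurable_sqr_normc; apply: cmeasurableB;
  by apply: cmeasurable_ltp_impulse; exact: measurable_fourier_ltp.
rewrite /lti_h2dist /lti_h2norm.
under [in leRHS]eq_integral do rewrite Re_trace_adjmx -/(M _) -/(S _).
rewrite -[(Num.sqrt _)%:E]/(sqrte ((2 * N).+1%:R)%:E).
rewrite -sqrteM ?lee_fin//.
rewrite /ltp_h2dist /ltp_h2norm lee_sqrt; last first.
  by rewrite mule_ge0 ?lee_fin//; apply: integral_ge0.
rewrite (tonelli_rectangle _ _ mg)//; last by move=> z; rewrite lee_fin sqr_ge0.
have Tinv0 : 0 <= T^-1 by rewrite invr_ge0 ltW.
apply: (@le_trans _ _ ((T^-1)%:E *
   \int[mu]_(r in `[0%R, +oo[) (((2 * N).+1%:R * T)%:E * (S r)%:E))%E).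
  apply: lee_wpmul2l; first by rewrite lee_fin.
  apply: ge0_le_integral => //.
  - by move=> r _; apply: integral_ge0 => t _; rewrite lee_fin sqr_ge0.
  - apply: (@measurable_funS _ _ _ _ setT) => //.
    apply: (measurable_sectional_integral_snd _ mg) => // z.
    by rewrite lee_fin sqr_ge0.
  - exact: measurable_funS (measurable_funeM _ mS).
  move=> r _; rewrite -EFinM; apply: le_trans (integral_bitrig_le (M r) r T0).
  rewrite le_eqVlt; apply/orP; left; apply/eqP; apply: eq_integral => t _.
  rewrite !ltp_impulse_fourierE subKr -sumrB; congr ((Normc.normc _ ^+ 2)%:E).
  apply: eq_bigr => j _; rewrite -sumrB; apply: eq_bigr => k _.
  by rewrite -!mulrBr !mxE.
rewrite ge0_integralZl_EFin//; last first.
- by rewrite mulr_ge0// ltW.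
- exact: measurable_funS mS.
by rewrite muleA -EFinM mulrCA mulVf ?gt_eqF// mulr1.
Qed.

End Systems.

Theorem corollary4p3 (R : realType) (n r N : nat) (T : R) (Q : 'M[R]_n)
    (b c : R -> 'cV[R]_n) (b_ c_ : int -> 'cV[R[i]]_n) (V W : 'M[R]_(n, r)) :
  0 < T ->
  (forall t, b (t + T) = b t) ->
  (forall t, c (t + T) = c t) ->
  fourier_expansion T b b_ ->
  fourier_expansion T c c_ ->
  W^T *m V = 1%:M ->
  let G := LTP Q (fun t => toC (b t)) (fun t => toC (c t)^T) in
  let GN := fourier_ltp T N Q b_ (fun k => (c_ k)^T) in
  let GNr := fourier_ltp T N (W^T *m Q *m V)
               (fun k => toC W^T *m b_ k) (fun k => (c_ k)^T *m toC V) in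
  let HN := fourier_lti N Q b_ c_ in
  let HNr := petrov_galerkin V W HN in
  (ltp_h2dist T G GNr <= ltp_h2dist T G GN + ltp_h2dist T GN GNr)%E /\
  (ltp_h2dist T G GN + ltp_h2dist T GN GNr
     <= ltp_h2dist T G GN
        + (Num.sqrt (2 * N + 1)%:R)%:E * lti_h2dist HN HNr)%E.
Proof.
move=> T0 bT cT [ib _ _] [ic _ _] _ G GN GNr HN HNr; split.
  apply: ltp_h2dist_triangle => //; try exact: measurable_fourier_ltp.
  apply: (measurable_periodic_ltp _ T0) => // i.
  - by case/integrableP: (ib i) => /measurable_EFinP.
  - by case/integrableP: (ic i) => /measurable_EFinP.
rewrite leeD2l// addn1 /HNr /HN petrov_galerkin_fourier.
have -> : GNr = fourier_ltp T N (W^T *m Q *m V) (fun k => toC W^T *m b_ k)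
    (fun k => ((toC V)^T *m c_ k)^T).
  by rewrite /GNr; congr fourier_ltp; apply/funext => k; rewrite trmx_mul trmxK.
exact: fourier_ltp_h2dist_le.
Qed.
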